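(* Let $D$ be a countably based coherent domain, let $C=\{0,1\}^\omega$ be the Cantor set of maximal elements of the Cantor tree $CT$, and let $\nu_C$ be Haar measure on $C$ viewed as a countable product of two-point groups. For every Borel sub-probability measure $\mu$ on $D$ there is a measurable partial map $f_\mu\colon C\rightharpoonup D$ (defined on a Borel subset of $C$) satisfying $f_\mu\,\nu_C=\mu$.
   Context: $CT=\{0,1\}^*\cup\{0,1\}^\omega$ with the prefix order; $C$ carries the relative Scott (equivalently product) topology. $\nu_C$ is the product of the uniform measures on $\{0,1\}$. A domain is coherent if its Lawson topology (common refinement of the Scott topology and the topology generated by complements of finitely generated upper sets) is compact; countably based means having a countable basis. $D$ carries its Borel $\sigma$-algebra (the Scott and Lawson Borel structures coincide here). $f_\mu\,\nu_C$ denotes the push-forward $A\mapsto\nu_C(f_\mu^{-1}(A))$, a sub-probability measure. *)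

(* Defs.v *)
From HB Require Import structures.
From mathcomp Require Import all_boot all_order all_algebra.
From mathcomp Require Import all_classical all_reals all_analysis.
From mathcomp Require Import zify ring lra.

Set Implicit Arguments.
Unset Strict Implicit.
Unset Printing Implicit Defensive.

Import Order.TTheory GRing.Theory Num.Theory.

Local Open Scope classical_set_scope.
Local Open Scope ring_scope.

Section domains.
Context {d : Order.disp_t} {D : porderType d}.
Implicit Types (A B F U : set D) (x y s : D).

Definition directed A :=
  A !=set0 /\
  forall x y, A x -> A y -> exists2 z, A z & (x <= z)%O /\ (y <= z)%O.

Definition way_below x y :=
  forall A s, directed A -> isLub A s -> (y <= s)%O ->
  exists2 a, A a & (x <= a)%O.

Definition is_basis B :=
  forall x, let Bx := B `&` [set y | way_below y x] in
  directed Bx /\ isLub Bx x.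

Definition up_set F : set D := [set y | exists2 x, F x & (x <= y)%O].

Definition scott_open U :=
  (forall x y, U x -> (x <= y)%O -> U y) /\
  (forall A s, directed A -> isLub A s -> U s -> exists2 a, A a & U a).

Lemma scott_openT : scott_open setT.
Proof. by split=> // A s [[a Aa] _] _ _; exists a. Qed.

Lemma scott_openI : setI_closed scott_open.
Proof.
move=> U V [Uup Uin] [Vup Vin]; split.
  by move=> x y [Ux Vx] xy; split; [exact: Uup xy | exact: Vup xy].
move=> A s dA sA [Us Vs].
have [a Aa Ua] := Uin _ _ dA sA Us.
have [b Ab Vb] := Vin _ _ dA sA Vs.
have [c Ac [ac bc]] := dA.2 a b Aa Ab.
by exists c => //; split; [exact: Uup ac | exact: Vup bc].
Qed.

Lemma scott_open_bigcup (I : Type) (U : I -> set D) :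
  (forall i, scott_open (U i)) -> scott_open (\bigcup_i U i).
Proof.
move=> oU; split.
  by move=> x y [i _ Ux] xy; exists i => //; exact: (oU i).1 xy.
move=> A s dA sA [i _ Us].
by have [a Aa Ua] := (oU i).2 _ _ dA sA Us; exists a => //; exists i.
Qed.

End domains.

Definition is_dcpo (d : Order.disp_t) (D : porderType d) :=
  forall A : set D, directed A -> exists s, isLub A s.

Definition is_domain (d : Order.disp_t) (D : porderType d) :=
  is_dcpo D /\ is_basis [set: D].

Definition countably_based (d : Order.disp_t) (D : porderType d) :=
  exists2 B : set D, countable B & is_basis B.

(* [D] with its Scott topology; measurable types of the library are pointed,
   so the alias also records a point of [D]. *)
Definition scott (d : Order.disp_t) (D : porderType d) (x0 : D) : Type := D.

HB.instance Definition _ (d : Order.disp_t) (D : porderType d) (x0 : D) :=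
  Choice.on (scott x0).
HB.instance Definition _ (d : Order.disp_t) (D : porderType d) (x0 : D) :=
  isPointed.Build (scott x0) x0.
HB.instance Definition _ (d : Order.disp_t) (D : porderType d) (x0 : D) :=
  isOpenTopological.Build (scott x0)
    (@scott_openT d D) (@scott_openI d D) (@scott_open_bigcup d D).

Definition lawson (D : Type) : Type := D.

Definition lawson_subbase (d : Order.disp_t) (D : porderType d) : set (set D) :=
  @scott_open d D `|`
  [set ~` up_set F | F in @finite_set D].

HB.instance Definition _ (d : Order.disp_t) (D : porderType d) :=
  Choice.on (lawson D).
HB.instance Definition _ (d : Order.disp_t) (D : porderType d) :=
  isSubBaseTopological.Build (lawson D) (@lawson_subbase d D) id.

Definition coherent (d : Order.disp_t) (D : porderType d) :=
  compact [set: lawson D].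

Definition borel (T : ptopologicalType) : Type := g_sigma_algebraType (@open T).

HB.instance Definition _ (T : ptopologicalType) := Measurable.on (borel T).

(* Characterizes the product of the uniform measures on [bool], that is, the
   normalized Haar measure of the countable power of the two-point group. *)
Definition uniform_product (R : realType)
    (nu : probability (borel cantor_space) R) :=
  forall (n : nat) (A : nat -> set bool),
  nu [set x | forall i, (i < n)%N -> A i (x i)] =
  (\prod_(i < n) bernoulli_prob 2^-1 (A i))%E.

(* Existence of the product measure: the image of Lebesgue measure on [0, 1[
   under binary expansion. *)
Section coin.
Context {R : realType}.
Local Notation mu := (@lebesgue_measure R).

Definition word_cylinder n (w : nat -> bool) : set cantor_space :=
  [set x | forall i, (i < n)%N -> x i = w i].

Lemma open_word_cylinder (U : set cantor_space) (x : cantor_space) :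
  open U -> U x -> exists n, word_cylinder n x `<=` U.
Proof.
move=> oU Ux; apply: contrapT => /forallNP noU.
have /choice[y yP] n : exists y, word_cylinder n x y /\ ~ U y.
  apply: contrapT => /forallNP h; apply: (noU n) => y xy.
  by apply: contrapT => nU; apply: (h y).
have : (y : nat -> {ptws nat -> bool}) @ \oo --> (x : {ptws nat -> bool}).
  apply/pointwise_cvgP => i A /= /nbhs_singleton Axi.
  exists i.+1 => //= n /= ni.
  by rewrite (yP n).1.
move=> /(_ U) []; first exact: open_nbhs_nbhs.
by move=> n _ /(_ n (leqnn n)) /= /(yP n).2.
Qed.

Definition digits (x : R) : borel cantor_space :=
  fun i => odd (Num.truncn (x * 2 ^+ i.+1)).

Fixpoint word_value n (w : nat -> bool) : nat :=
  if n is m.+1 then ((word_value m w).*2 + w m)%N else 0%N.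

Lemma word_value_lt n w : (word_value n w < 2 ^ n)%N.
Proof. by elim: n => //= n; rewrite expnS; case: (w n); lia. Qed.

Lemma truncn_half (x : R) : 0 <= x -> (Num.truncn (x * 2))./2 = Num.truncn x.
Proof.
move=> x0; apply/esym/truncn_def.
have /truncn_itv := mulr_ge0 x0 (ler0n R 2).
set t := Num.truncn _; rewrite -{1 2}(odd_double_half t).
by case: (odd t); rewrite -muln2 -!natr1 /= ?add0n ?natrD natrM => /andP[? ?]; lra.
Qed.

Lemma digitsP n w (x : R) : 0 <= x < 1 ->
  word_cylinder n w (digits x) <-> Num.truncn (x * 2 ^+ n) = word_value n w.
Proof.
move=> /andP[x0 x1]; elim: n => [|n IH].
  by split=> // _; rewrite expr0 mulr1; apply: truncn_def; rewrite x0.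
have xn0 : 0 <= x * 2 ^+ n by rewrite mulr_ge0// exprn_ge0.
have hx := truncn_half xn0.
have e : x * 2 ^+ n.+1 = x * 2 ^+ n * 2 by rewrite exprSr mulrA.
split.
  move=> h /=; have /IH <- : word_cylinder n w (digits x).
    by move=> i /ltnW; exact: h.
  rewrite -hx -e -(h n (ltnSn n)) /digits.
  by rewrite addnC odd_double_half.
move=> /= h i; rewrite ltnS leq_eqVlt => /predU1P[->|].
  by rewrite /digits h oddD odd_double/=; case: (w n).
apply: (IH.2 _).
rewrite -hx -e h; by case: (w n); lia.
Qed.

Lemma digits_cylinder n w :
  `[0, 1[ `&` digits @^-1` word_cylinder n w =
  [set` `[(word_value n w)%:R / 2 ^+ n, (word_value n w).+1%:R / 2 ^+ n[ ] :> set R.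
Proof.
have p0 : 0 < 2 ^+ n :> R by rewrite exprn_gt0.
apply/seteqP; split=> x /=; rewrite !in_itv/=.
  move=> [x01 /(digitsP _ _ x01) <-].
  rewrite ler_pdivrMr// ltr_pdivlMr//; apply: truncn_itv.
  by rewrite mulr_ge0 ?(ltW p0)//; case/andP: x01.
rewrite ler_pdivrMr// ltr_pdivlMr// => /andP[h1 h2].
have x0 : 0 <= x.
  by rewrite -(pmulr_lge0 _ p0) (le_trans _ h1).
have x01 : 0 <= x < 1.
  rewrite x0/= -(ltr_pM2r p0) mul1r (lt_le_trans h2)// -natrX ler_nat.
  exact: word_value_lt.
split=> //; apply/digitsP => //; apply: truncn_def; exact/andP.
Qed.

Lemma measurable_digits : measurable_fun ([set` `[(0:R), 1[] : set (measurableTypeR R)) digits.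
Proof.
have e : @measurable _ (borel cantor_space) = <<s @open cantor_space >> by [].
refine (@measurability _ _ (measurableTypeR R) (borel cantor_space) _ _ _ e _) => _ [U oU <-].
pose S := [set s : seq bool | word_cylinder (size s) (nth false s) `<=` U].
rewrite (_ : U = \bigcup_(s in S) word_cylinder (size s) (nth false s)); last first.
  apply/seteqP; split=> [x Ux|x [s Ss]]; last exact: Ss.
  have [n nU] := open_word_cylinder oU Ux.
  exists (mkseq x n); last first.
    by move=> i; rewrite size_mkseq => iN; rewrite nth_mkseq.
  move=> y; rewrite size_mkseq => yx; apply: nU => i iN.
  by rewrite yx// nth_mkseq.
rewrite preimage_bigcup setI_bigcupr bigcup_mkcond.
apply: countable_bigcupT_measurable => [|s]; first exact: countableP.
case: ifPn => // _.
by rewrite digits_cylinder; exact: measurable_itv.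
Qed.

Definition coin_measure (A : set (borel cantor_space)) : \bar R :=
  mu (`[0, 1[ `&` digits @^-1` A).

Let coin0 : coin_measure set0 = 0%E.
Proof. by rewrite /coin_measure preimage_set0 setI0 measure0. Qed.

Let coin_ge0 A : (0 <= coin_measure A)%E. Proof. exact: measure_ge0. Qed.

Let coin_sigma_additive : semi_sigma_additive coin_measure.
Proof.
move=> F mF tF mUF; rewrite /coin_measure preimage_bigcup setI_bigcupr.
apply: measure_semi_sigma_additive.
- by move=> n; exact: measurable_digits.
- apply/trivIsetP => i j _ _ ij; rewrite setIACA setIid -preimage_setI.
  by have /trivIsetP -> := tF; rewrite ?preimage_set0 ?setI0.
- by rewrite -setI_bigcupr -preimage_bigcup; exact: measurable_digits.
Qed.

HB.instance Definition _ := isMeasure.Build _ _ _ coin_measure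
  coin0 coin_ge0 coin_sigma_additive.

Let coinT : coin_measure setT = 1%E.
Proof.
rewrite /coin_measure preimage_setT setIT lebesgue_measure_itv/= lte_fin ltr01.
by rewrite sube0.
Qed.

HB.instance Definition _ := Measure_isProbability.Build _ _ _ coin_measure coinT.

Lemma coin_word n w : coin_measure (word_cylinder n w) = (2^-1 ^+ n)%:E.
Proof.
rewrite /coin_measure digits_cylinder lebesgue_measure_itv/= lte_fin.
rewrite ltr_pM2r ?invr_gt0 ?exprn_gt0// ltr_nat ltnSn.
by rewrite -EFinB -mulrBl -natr1 addrAC subrr add0r mul1r exprVn.
Qed.

Definition cylinder n (A : nat -> set bool) : set (borel cantor_space) :=
  [set x | forall i, (i < n)%N -> A i (x i)].

Lemma measurable_coord i (b : bool) :
  measurable ([set x | x i = b] : set (borel cantor_space)).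
Proof.
apply: sub_sigma_algebra.
have c : continuous (fun x : cantor_space => x i).
  exact: (@proj_continuous nat (fun=> bool) i).
by apply: (continuousP _).1 c [set b] _; exact: discrete_open.
Qed.

Lemma measurable_cylinder n A : measurable (cylinder n A).
Proof.
rewrite (_ : cylinder n A =
  \bigcap_(i in `I_n) \bigcup_(b in A i) [set x | x i = b]); last first.
  apply/seteqP; split=> x h i iN; first by exists (x i) => //; exact: h.
  by have [b Ab] := h i iN; rewrite /= => ->.
apply: bigcap_measurableType => i _.
rewrite bigcup_mkcond; apply: countable_bigcupT_measurable => [|b]; first exact: countableP.
by case: ifPn => // _; exact: measurable_coord.
Qed.

Lemma bernoulli_half_set1 b : bernoulli_prob (2^-1 : R) [set b] = (2^-1)%:E.
Proof.
have p01 : (0 <= (2^-1 : R) <= 1) by lra.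
rewrite bernoulli_probE//; case: b => /=.
  rewrite diracE mem_set// diracE memNset//.
  by rewrite mule1 mule0 adde0.
rewrite diracE memNset// diracE mem_set// mule1 mule0 add0e; congr EFin.
by rewrite /unstable.onem; lra.
Qed.

Lemma coin_product_word (n : nat) (w : nat -> bool) :
  coin_measure (cylinder n (fun i => [set w i])) =
  (\prod_(i < n) bernoulli_prob (2^-1 : R) [set w i])%E.
Proof.
rewrite -[cylinder _ _]/(word_cylinder n w) coin_word.
elim: n => [|n IH]; first by rewrite big_ord0.
by rewrite big_ord_recr/= -IH exprSr bernoulli_half_set1 EFinM.
Qed.

End coin.

Lemma uniform_product_coin (R : realType) :
  uniform_product (@coin_measure R).
Proof.
move=> n A.
suff h j : forall A : nat -> set bool,
    (forall i, (j <= i)%N -> exists b, A i = [set b]) ->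
    coin_measure (cylinder n A) =
      (\prod_(i < n) bernoulli_prob (2^-1 : R) (A i))%E.
  pose B i := if (i < n)%N then A i else [set true].
  transitivity (@coin_measure R (cylinder n B)).
    congr coin_measure; apply/seteqP.
    by split=> x + i iN => /(_ i iN); rewrite /B iN.
  rewrite (h n B); last by move=> i ni; rewrite /B ltnNge ni; exists true.
  by apply: eq_bigr => i _; rewrite /B ltn_ord.
elim: j => [{}A sA|j IH {}A sA].
  have /choice[w wA] i : exists b, A i = [set b] by exact: sA.
  by rewrite (funext wA) coin_product_word.
have upd (X : set bool) i : let B := fun k => if k == j then X else A k in
    (exists b, X = [set b]) -> (j <= i)%N -> exists b, B i = [set b].
  move=> B Xb; rewrite /B; case: eqVneq => // ij ji; apply: sA.
  by rewrite ltn_neqAle eq_sym ij.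
have [nj|jn] := leqP n j.
  pose B k := if k == j then [set true] else A k.
  have BA i : (i < n)%N -> B i = A i.
    by move=> iN; rewrite /B ifN// neq_ltn (leq_trans iN nj).
  transitivity (@coin_measure R (cylinder n B)).
    congr coin_measure; apply/seteqP.
    by split=> x + i iN => /(_ i iN); rewrite BA.
  rewrite IH; last by move=> i; apply: upd; exists true.
  by apply: eq_bigr => i _; rewrite BA.
have prodE (X : set bool) :
    (\prod_(i < n) bernoulli_prob (2^-1 : R) (if i == j :> nat then X else A i) =
     bernoulli_prob (2^-1 : R) X *
     \prod_(i < n | i != Ordinal jn) bernoulli_prob (2^-1 : R) (A i))%E.
  rewrite (bigD1 (Ordinal jn))//= eqxx; congr (_ * _)%E.
  by apply: eq_bigr => i ij; rewrite ifN.
have single b : A j = [set b] -> coin_measure (cylinder n A) =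
      (\prod_(i < n) bernoulli_prob (2^-1 : R) (A i))%E.
  move=> Ab; apply: IH => i; rewrite leq_eqVlt => /predU1P[<-|]; last exact: sA.
  by exists b.
have [/eqP/single //|/eqP/single //|/eqP A0|/eqP AT] := set_bool (A j).
  rewrite (bigD1 (Ordinal jn))//= A0 measure0 mul0e.
  rewrite (_ : cylinder n A = set0) ?measure0// -subset0 => x /(_ _ jn).
  by rewrite A0.
pose B b k := if k == j then [set b] else A k.
have -> : cylinder n A = cylinder n (B true) `|` cylinder n (B false).
  apply/seteqP; split=> x.
    move=> xA; case xj : (x j); [left|right] => i iN; rewrite /B;
      by case: eqVneq => [->|_] //; exact: xA.
  by move=> [] xB i iN; case: (eqVneq i j) => [->|ij];
    rewrite ?AT//; have := xB i iN; rewrite /B (negbTE ij).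
transitivity (@coin_measure R (cylinder n (B true)) +
              @coin_measure R (cylinder n (B false)))%E.
  apply: measureU; [exact: measurable_cylinder | exact: measurable_cylinder |].
  rewrite -subset0 => x [/(_ _ jn) + /(_ _ jn)].
  by rewrite /B eqxx /= => -> .
rewrite (IH (B true)); last by move=> i; apply: upd; exists true.
rewrite (IH (B false)); last by move=> i; apply: upd; exists false.
rewrite !prodE [RHS](bigD1 (Ordinal jn))//= AT probability_setT mul1e.
rewrite !bernoulli_half_set1 -ge0_muleDl ?lee_fin ?invr_ge0//.
by rewrite -EFinD (_ : 2^-1 + 2^-1 = 1 :> R) ?mul1e//; lra.
Qed.

(* Main.v *)
Require Import Defs.
From HB Require Import structures.
From mathcomp Require Import all_boot all_order all_algebra.
From mathcomp Require Import all_classical all_reals all_analysis.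
From mathcomp Require Import measurable_realfun lra.

Set Implicit Arguments.
Unset Strict Implicit.
Unset Printing Implicit Defensive.

Import Order.TTheory GRing.Theory Num.Theory.
Import numFieldNormedType.Exports.

Local Open Scope classical_set_scope.
Local Open Scope ring_scope.

(* Enumerate a countable basis as b_0, b_1, ... and code a point x of D by the
   binary sequence of the truth values of b_n << x.  The codes of points are
   exactly the rounded ideals of the basis, hence they form a Borel subset of the
   Cantor space, and every Borel set of D is the preimage of a Borel set of codes.
   It therefore suffices to realize the image m of mu in the Cantor space.  The
   binary value of a random sequence is uniform on [0, 1[, and the lexicographic
   quantile transform carries Lebesgue measure on [0, m(C)[ to m; the wanted map
   decodes the result, on the sequences for which it is a rounded ideal. *)

(** * The way-below relation *)

Section way_below_theory.
Context {d : Order.disp_t} {D : porderType d}.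
Implicit Types (x y z : D) (B U : set D).

Lemma way_below_le x y : way_below x y -> (x <= y)%O.
Proof.
move=> /(_ [set y] y)[||//|_ -> //]; last by split=> [_ ->|b /(_ y)]//; exact.
by split=> [|_ _ -> ->]; exists y.
Qed.

Lemma way_below_le_trans x y z : way_below x y -> (y <= z)%O -> way_below x z.
Proof. by move=> xy yz A s dA sA zs; exact: (xy _ _ dA sA (le_trans yz zs)). Qed.

Lemma le_way_below_trans x y z : (x <= y)%O -> way_below y z -> way_below x z.
Proof.
move=> xy yz A s dA sA zs; have [a Aa ya] := yz _ _ dA sA zs.
by exists a => //; exact: le_trans xy ya.
Qed.

Lemma way_below_trans x y z : way_below x y -> way_below y z -> way_below x z.
Proof. by move=> xy /way_below_le; exact: way_below_le_trans. Qed.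

(** The basis elements two way-below steps under [y] form a directed set with supremum [y], to which
    the definition of [way_below x y] applies. *)
Lemma way_below_interpolation B x y : is_basis B -> way_below x y ->
  exists z, [/\ B z, way_below x z & way_below z y].
Proof.
move=> Bb xy.
pose A := [set u | B u /\ exists z, [/\ B z, way_below u z & way_below z y]].
have dA : directed A.
  split.
    have [[z [Bz zy]] _] := (Bb y).1; have [[u [Bu uz]] _] := (Bb z).1.
    by exists u; split=> //; exists z.
  move=> u1 u2 [Bu1 [z1 [Bz1 uz1 zy1]]] [Bu2 [z2 [Bz2 uz2 zy2]]].
  have [z [Bz zy] [z1z z2z]] :=
    (Bb y).1.2 z1 z2 (conj Bz1 zy1) (conj Bz2 zy2).
  have [u [Bu uz] u12] := (Bb z).1.2 u1 u2
    (conj Bu1 (way_below_le_trans uz1 z1z))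
    (conj Bu2 (way_below_le_trans uz2 z2z)).
  by exists u => //; split=> //; exists z.
have sA : isLub A y.
  split=> [u [_ [z [_ uz zy]]]|b ub].
    exact: way_below_le (way_below_trans uz zy).
  apply: (Bb y).2.2 => z [Bz zy]; apply: (Bb z).2.2 => u [Bu uz].
  by apply: ub; split=> //; exists z.
have [u [_ [z [Bz uz zy]]] xu] := xy _ _ dA sA (lexx y).
by exists z; split=> //; exact: le_way_below_trans xu uz.
Qed.

Lemma scott_open_way_above B x : is_basis B -> scott_open [set y | way_below x y].
Proof.
move=> Bb; split=> [y z|A s dA sA /= /(way_below_interpolation Bb)[z [_ xz zs]]].
  exact: way_below_le_trans.
have [a Aa za] := zs _ _ dA sA (lexx s).
by exists a => //; exact: way_below_le_trans xz za.
Qed.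

Lemma scott_open_basisE B U : is_basis B -> scott_open U ->
  U = \bigcup_(b in B `&` U) [set y | way_below b y].
Proof.
move=> Bb [Uup Uin]; apply/seteqP; split=> [x Ux|x [b [_ Ub] bx]].
  by have [b [Bb' bx] Ub] := Uin _ _ (Bb x).1 (Bb x).2 Ux; exists b.
exact: Uup Ub (way_below_le bx).
Qed.

End way_below_theory.

(** * Codes of points and rounded ideals *)

Section rounded_ideals.
Context {d : Order.disp_t} {D : porderType d}.
Variable b : nat -> D.

Definition basis_code (x : D) : borel cantor_space := fun n => `[< way_below (b n) x >].

(** The three conditions are: nonempty, directed, and lower for the way-below relation. Taking
    [n = m] in the second gives roundedness. Stated by countable operations on digit conditions,
    they are visibly Borel. *)
Definition rounded_ideal : set (borel cantor_space) :=
  (\bigcup_n [set w | w n = true]) `&`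
  (\bigcap_n \bigcap_m ([set w | w n = false] `|` ([set w | w m = false] `|`
    \bigcup_(k in [set k | way_below (b n) (b k) /\ way_below (b m) (b k)])
      [set w | w k = true]))) `&`
  (\bigcap_n \bigcap_(m in [set m | way_below (b n) (b m)])
    ([set w | w m = false] `|` [set w | w n = true])).

Lemma measurable_rounded_ideal : measurable rounded_ideal.
Proof.
apply: measurableI; first apply: measurableI.
- by apply: bigcup_measurable => n _; exact: measurable_coord.
- apply: bigcap_measurableType => n _; apply: bigcap_measurableType => m _.
  apply: measurableU; first exact: measurable_coord.
  apply: measurableU; first exact: measurable_coord.
  by apply: bigcup_measurable => k _; exact: measurable_coord.
- apply: bigcap_measurableType => n _; apply: bigcap_measurableType => m _.
  by apply: measurableU; exact: measurable_coord.
Qed.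

(** Interpolation makes the code of a point rounded; conversely, a rounded ideal is the code of its
    supremum, which exists in a dcpo. *)
Lemma range_basis_code : is_dcpo D -> is_basis (range b) ->
  range basis_code = rounded_ideal.
Proof.
move=> dcD Bb; apply/seteqP; split=> [_ [x _ <-]|w [[[n0 _ wn0] wdir] wlow]].
  split; first split.
  - have [[_ [[n _ <-] nx]] _] := (Bb x).1.
    by exists n => //; exact/asboolP.
  - move=> n _ m _.
    have [/asboolP nx|nnx] := boolP (basis_code x n); last by left; exact/negbTE.
    have [/asboolP mx|nmx] := boolP (basis_code x m);
      last by right; left; exact/negbTE.
    right; right.
    have [z1 [Bz1 nz1 zx1]] := way_below_interpolation Bb nx.
    have [z2 [Bz2 mz2 zx2]] := way_below_interpolation Bb mx.
    have [_ [[k _ <-] kx] [z1k z2k]] :=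
      (Bb x).1.2 z1 z2 (conj Bz1 zx1) (conj Bz2 zx2).
    exists k; last exact/asboolP.
    by split; [exact: way_below_le_trans z1k|exact: way_below_le_trans z2k].
  - move=> n _ m nm.
    have [/asboolP mx|nmx] := boolP (basis_code x m); last by left; exact/negbTE.
    by right; apply/asboolP; exact: way_below_trans mx.
have wup n m : w n -> w m ->
    exists2 k, w k & way_below (b n) (b k) /\ way_below (b m) (b k).
  move=> wn wm; have [/=|[/=|[k ? ?]]] := wdir n I m I; rewrite ?wn ?wm//.
  by exists k.
pose A := [set b n | n in [set n | w n]].
have dA : directed A.
  split; first by exists (b n0), n0.
  move=> _ _ [n /= wn <-] [m /= wm <-].
  have [k wk [nk mk]] := wup n m wn wm.
  by exists (b k); [exists k|split; exact: way_below_le].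
have [s sA] := dcD _ dA.
exists s => //; apply/funext => n; apply/idP/idP => [/asboolP ns|wn].
  have [_ [m /= wm <-] nm] := ns _ _ dA sA (lexx s).
  (* So far [b n] is only below [b m] in the order, while the third condition needs the way-below
     relation; roundedness supplies a [b k] way above [b m]. *)
  have [k wk [mk _]] := wup m m wm wm.
  have [/=|//] := wlow n I k (le_way_below_trans nm mk).
  by rewrite wk.
apply/asboolP; have [k wk [nk _]] := wup n n wn wn.
by apply: (way_below_le_trans nk); apply: sA.1; exists k.
Qed.

End rounded_ideals.

(** * Cylinders and uniqueness of measures on the Cantor space *)

Definition word_cylinders : set (set (borel cantor_space)) :=
  [set A | A = set0 \/ exists n w, A = word_cylinder n w].

Lemma measurable_word_cylinder n w :
  measurable (word_cylinder n w : set (borel cantor_space)).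
Proof. exact: (measurable_cylinder n (fun i => [set w i])). Qed.

Lemma word_cylinder0 w : word_cylinder 0 w = setT.
Proof. by apply/seteqP. Qed.

Lemma word_cylinderS n w : word_cylinder n.+1 w =
  word_cylinder n w `&` [set x | x n = w n].
Proof.
apply/seteqP; split=> x.
  by move=> xw; split; [move=> i ni; apply: xw; exact: ltnW|exact: xw].
move=> [xw xn] i; rewrite ltnS leq_eqVlt => /predU1P[->//|]; exact: xw.
Qed.

(** Two cylinders are nested or disjoint; the disjoint case is why [word_cylinders] includes the
    empty set. *)
Lemma setI_closed_word_cylinders : setI_closed word_cylinders.
Proof.
have sub m n v w : (m <= n)%N ->
    word_cylinders (word_cylinder m v `&` word_cylinder n w).
  move=> mn.
  have [vw|/existsNP[i /not_implyP[im vwi]]] :=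
      pselect (forall i, (i < m)%N -> v i = w i).
    right; exists n, w; rewrite setIidr// => x xw i im.
    by rewrite xw ?vw// (leq_trans im).
  left; rewrite -subset0 => x [xv xw]; apply: vwi.
  by rewrite -xv// xw// (leq_trans im).
move=> A B [->|[m [v ->]]]; first by left; rewrite set0I.
move=> [->|[n [w ->]]]; first by left; rewrite setI0.
by case/orP: (leq_total m n) => h; [exact: sub|rewrite setIC; exact: sub].
Qed.

(** An open set is the union of the cylinders it contains, and there are countably many finite
    words. *)
Lemma measurable_word_cylindersE :
  @measurable _ (borel cantor_space) = <<s word_cylinders >>.
Proof.
apply/seteqP; split; last first.
  apply: smallest_sub; first exact: sigma_algebra_measurable.
  by move=> _ [->|[n [w ->]]] //; exact: measurable_word_cylinder.
apply: smallest_sub; first exact: smallest_sigma_algebra.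
move=> U oU.
pose S := [set s : seq bool | word_cylinder (size s) (nth false s) `<=` U].
rewrite (_ : U = \bigcup_(s in S) word_cylinder (size s) (nth false s)); last first.
  apply/seteqP; split=> [x Ux|x [s Ss]]; last exact: Ss.
  have [n nU] := open_word_cylinder oU Ux.
  exists (mkseq x n); last first.
    by move=> i; rewrite size_mkseq => iN; rewrite nth_mkseq.
  move=> y; rewrite size_mkseq => yx; apply: nU => i iN.
  by rewrite yx// nth_mkseq.
rewrite bigcup_mkcond.
apply: (@countable_bigcupT_measurable _ (g_sigma_algebraType word_cylinders))
  => [|s]; first exact: countableP.
case: ifPn => // _; apply: sub_sigma_algebra; right.
by exists (size s), (nth false s).
Qed.

Lemma measurable_fun_cantor d (T : measurableType d) (f : T -> borel cantor_space) :
  (forall n w, measurable (f @^-1` word_cylinder n w)) -> measurable_fun setT f.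
Proof.
move=> mf; apply: (measurability _ measurable_word_cylindersE).
move=> _ [_ [->|[n [w ->]]] <-]; rewrite setTI; last exact: mf.
by rewrite preimage_set0.
Qed.

(** A finite measure is determined by its values on a generating family closed under
    intersection. *)
Lemma cantor_measure_unique (R : realType)
    (m1 m2 : {measure set (borel cantor_space) -> \bar R}) :
  (m1 setT < +oo)%E ->
  (forall n w, m1 (word_cylinder n w) = m2 (word_cylinder n w)) ->
  forall A, measurable A -> m1 A = m2 A.
Proof.
move=> m1T m12; apply: (measure_unique word_cylinders (fun=> setT)).
- exact: measurable_word_cylindersE.
- exact: setI_closed_word_cylinders.
- by move=> _; right; exists 0%N, (fun=> true); rewrite word_cylinder0.
- by rewrite bigcup_const//; exists 0%N.
- by move=> _ [->|[n [w ->]]]; rewrite ?measure0.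
- by [].
Qed.

(** This replaces an arbitrary [nu] by the image of Lebesgue measure under [digits]. *)
Lemma uniform_product_coinE (R : realType)
    (nu : probability (borel cantor_space) R) : uniform_product nu ->
  forall A, measurable A -> nu A = coin_measure A.
Proof.
move=> hnu; apply: (@cantor_measure_unique R nu coin_measure) => [|n w].
  by rewrite [X in (X < _)%E]probability_setT ltey.
exact: etrans (hnu n (fun i => [set w i])) (esym (coin_product_word n w)).
Qed.

(** * Binary values of sequences *)

Section binary_value.
Context {R : realType}.

Definition dyadic_approx n (w : borel cantor_space) : R :=
  (word_value n w)%:R / 2 ^+ n.

Definition binary_value (w : borel cantor_space) : R := limn (dyadic_approx ^~ w).

Lemma dyadic_approxS n w :
  dyadic_approx n.+1 w = dyadic_approx n w + (w n)%:R / 2 ^+ n.+1.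
Proof.
rewrite /dyadic_approx /= natrD mulrDl; congr (_ + _).
by rewrite -muln2 natrM exprSr -mulf_div divff// mulr1.
Qed.

Lemma is_cvg_dyadic_approx w : cvgn (dyadic_approx ^~ w).
Proof.
apply: nondecreasing_is_cvgn.
  apply/nondecreasing_seqP => n.
  by rewrite dyadic_approxS lerDl divr_ge0// exprn_ge0.
exists 1 => _ [n _ <-]; rewrite /dyadic_approx ler_pdivrMr ?exprn_gt0// mul1r.
by rewrite -natrX ler_nat ltnW// word_value_lt.
Qed.

Lemma measurable_dyadic_approx n : measurable_fun setT (dyadic_approx n).
Proof.
elim: n => [|n IH].
  rewrite (_ : dyadic_approx 0 = cst 0); first exact: measurable_cst.
  by apply/funext => w; rewrite /dyadic_approx /= mul0r.
rewrite (_ : dyadic_approx n.+1 = fun w : borel cantor_space =>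
    dyadic_approx n w + (w n)%:R / 2 ^+ n.+1); last first.
  by apply/funext => w; rewrite dyadic_approxS.
apply: measurable_funD => //; apply: measurable_funM => //.
apply: (@measurableT_comp _ _ _ _ _ _ (fun c : bool => c%:R : R)) => //.
apply: (measurable_fun_bool true); rewrite setTI.
exact: measurable_coord n true.
Qed.

Lemma measurable_binary_value : measurable_fun setT binary_value.
Proof.
apply: (@measurable_fun_cvg _ _ _ _ dyadic_approx) => [n|w _].
  exact: measurable_dyadic_approx.
exact: is_cvg_dyadic_approx.
Qed.

(** The first [n] digits of [x] encode the integer part of [x * 2 ^+ n], so the [n]-th approximation
    is within [2 ^- n] of [x]. *)
Lemma binary_value_digits (x : R) : 0 <= x < 1 -> binary_value (digits x) = x.
Proof.
move=> x01; apply/cvg_lim => //; apply/cvgrPdist_lt => e e0.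
have := near_infty_natSinv_expn_lt (PosNum e0).
apply: filterS => n /=; rewrite mul1r; apply: le_lt_trans.
have p0 : 0 < 2 ^+ n :> R by rewrite exprn_gt0.
rewrite /dyadic_approx.
have <- : Num.truncn (x * 2 ^+ n) = word_value n (digits x) by apply/digitsP.
have /truncn_itv : 0 <= x * 2 ^+ n by case/andP: x01 => ? _; rewrite mulr_ge0// ltW.
rewrite -ler_pdivrMr// -ltr_pdivlMr//.
rewrite -[(Num.truncn _).+1%:R]natr1 mulrDl mul1r => /andP[h1 h2].
by rewrite ler_norml; apply/andP; split; lra.
Qed.

(** On [[0, 1[], [binary_value] is a left inverse of [digits], so it carries [coin_measure] back to
    Lebesgue measure. *)
Lemma uniform_binary_value (nu : probability (borel cantor_space) R) (A : set R) :
  uniform_product nu -> measurable A ->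
  nu (binary_value @^-1` A) = lebesgue_measure (`[0, 1[ `&` A).
Proof.
move=> hnu mA; rewrite uniform_product_coinE//; last first.
  by rewrite -[X in measurable X]setTI; exact: measurable_binary_value.
congr lebesgue_measure; apply/seteqP; split=> x /= [x01];
  by rewrite /= binary_value_digits.
Qed.

End binary_value.

(* The interval [0, m(C)[ is cut, in lexicographic order, into consecutive
   intervals whose lengths are the masses of the cylinders of length n;
   [quantile] follows the nested intervals that contain a given point. *)
Section quantile.
Context {R : realType}.
Variable m : {measure set (borel cantor_space) -> \bar R}.
Hypothesis mT : (m setT < +oo)%E.

Definition mass n (w : nat -> bool) : R := fine (m (word_cylinder n w)).

Definition left_mass n (w : nat -> bool) : R :=
  fine (m (word_cylinder n w `&` [set x | x n = false])).

(** This is the total mass of the words of length [n] that precede [w] lexicographically: each digit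
    [true] passes over the sibling branch [false]. *)
Fixpoint left_end n (w : nat -> bool) : R :=
  if n is k.+1 then left_end k w + (if w k then left_mass k w else 0) else 0.

Lemma cantor_fin_num (A : set (borel cantor_space)) :
  measurable A -> m A \is a fin_num.
Proof.
move=> mA; rewrite ge0_fin_numE ?measure_ge0//.
by rewrite (le_lt_trans _ mT)// le_measure// inE.
Qed.

Lemma massE n w : (mass n w)%:E = m (word_cylinder n w).
Proof. by rewrite fineK// cantor_fin_num//; exact: measurable_word_cylinder. Qed.

Lemma mass_ge0 n w : 0 <= mass n w.
Proof. by rewrite fine_ge0// measure_ge0. Qed.

Lemma left_mass_ge0 n w : 0 <= left_mass n w.
Proof. by rewrite fine_ge0// measure_ge0. Qed.

Lemma massS n w :
  mass n.+1 w = if w n then mass n w - left_mass n w else left_mass n w.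
Proof.
case wn : (w n); last by rewrite /mass word_cylinderS wn.
have mC : measurable (word_cylinder n w : set (borel cantor_space)).
  exact: measurable_word_cylinder.
apply/EFin_inj; rewrite EFinB !massE word_cylinderS wn.
rewrite /left_mass fineK; last first.
  by apply: cantor_fin_num; apply: measurableI => //; exact: measurable_coord.
rewrite -measureD//; [|exact: measurable_coord|].
  congr (m _); rewrite setDE; congr (_ `&` _).
  by apply/seteqP; split=> x /=; case: (x n).
by rewrite -ge0_fin_numE ?measure_ge0//; exact: cantor_fin_num.
Qed.

Lemma left_mass_le n w : left_mass n w <= mass n w.
Proof.
have mC : measurable (word_cylinder n w : set (borel cantor_space)).
  exact: measurable_word_cylinder.
have mL : measurable (word_cylinder n w `&` [set x | x n = false]
    : set (borel cantor_space)).
  by apply: measurableI => //; exact: measurable_coord.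
by rewrite fine_le ?cantor_fin_num// le_measure ?inE//; exact: subIsetl.
Qed.

Lemma eq_word_cylinder n v w :
  word_cylinder n w v -> word_cylinder n v = word_cylinder n w.
Proof. by move=> vw; apply/seteqP; split=> x xv i ni; rewrite xv// vw. Qed.

Lemma eq_left_mass n v w : word_cylinder n w v -> left_mass n v = left_mass n w.
Proof. by move=> vw; rewrite /left_mass (eq_word_cylinder vw). Qed.

Lemma eq_left_end n v w : word_cylinder n w v -> left_end n v = left_end n w.
Proof.
elim: n => //= n IH; rewrite word_cylinderS => -[vw /= ->].
by rewrite IH// (eq_left_mass vw).
Qed.

(** A digit depends on all earlier ones, so the recursion carries the whole prefix. [left_end k] and
    [left_mass k] read only the first [k] digits, so padding by [false] is harmless. *)
Fixpoint quantile_prefix (u : R) n : seq bool :=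
  if n is k.+1 then
    let s := quantile_prefix u k in
    rcons s (left_end k (nth false s) + left_mass k (nth false s) <= u)
  else [::].

Definition quantile (u : R) : borel cantor_space :=
  fun n => nth false (quantile_prefix u n.+1) n.

Lemma size_quantile_prefix u n : size (quantile_prefix u n) = n.
Proof. by elim: n => //= n IH; rewrite size_rcons IH. Qed.

Lemma nth_quantile_prefix u n :
  word_cylinder n (nth false (quantile_prefix u n)) (quantile u).
Proof.
elim: n => // n IH; rewrite word_cylinderS; split=> // i ni.
by rewrite IH//= nth_rcons size_quantile_prefix ni.
Qed.

Lemma quantileE u n : quantile u n =
  (left_end n (quantile u) + left_mass n (quantile u) <= u).
Proof.
have h := @nth_quantile_prefix u n.
rewrite {1}/quantile /= nth_rcons size_quantile_prefix ltnn eqxx.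
by rewrite (eq_left_end h) (eq_left_mass h).
Qed.

(** While the first [n] digits are those of [w], the threshold for the next digit is constant; each
    digit thus adds one half-line condition on [u]. *)
Lemma quantile_word_cylinderS n w :
  quantile @^-1` word_cylinder n.+1 w = quantile @^-1` word_cylinder n w `&`
    [set u | (left_end n w + left_mass n w <= u) = w n].
Proof.
rewrite word_cylinderS; apply/seteqP.
by split=> u /= -[uw]; rewrite quantileE (eq_left_end uw) (eq_left_mass uw).
Qed.

Lemma measurable_quantile : measurable_fun setT (quantile : measurableTypeR R -> _).
Proof.
apply: measurable_fun_cantor => n w; elim: n => [|n IH].
  by rewrite word_cylinder0 preimage_setT.
rewrite quantile_word_cylinderS; apply: measurableI => //.
set c := left_end n w + _; case: (w n).
  rewrite (_ : mkset _ = [set` `[c, +oo[]); first exact: measurable_itv.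
  by apply/seteqP; split=> u /=; rewrite in_itv/= andbT.
rewrite (_ : mkset _ = [set` `]-oo, c[]); first exact: measurable_itv.
by apply/seteqP; split=> u /=; rewrite in_itv/= ltNge; [move=> ->|move/negbTE].
Qed.

(** Inductively, the threshold [left_end n w + left_mass n w] cuts the interval of a word into those
    of its two children. A point on the threshold goes right, in accordance with the half-open
    intervals. *)
Lemma quantile_itv n w :
  [set` `[0, fine (m setT)[] `&` quantile @^-1` word_cylinder n w =
  [set` `[left_end n w, left_end n w + mass n w[].
Proof.
elim: n => [|n IH].
  by rewrite /mass word_cylinder0 preimage_setT setIT /= add0r.
rewrite quantile_word_cylinderS setIA IH massS /=.
have le_mass := left_mass_le n w; have ge0 := left_mass_ge0 n w.
apply/seteqP; split=> u /=; rewrite !in_itv/=.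
  by move=> [/andP[? ?]]; case: (w n) => [?|/negbT]; rewrite -?ltNge; lra.
case: (w n) => /andP[? ?]; (split; first by apply/andP; split; lra); first lra.
by apply/negbTE; rewrite -ltNge; lra.
Qed.

(** Both sides are measures in [A]; they agree on cylinders because the interval of a word has its
    mass as length. *)
Lemma lebesgue_quantile A : measurable A ->
  lebesgue_measure ([set` `[0, fine (m setT)[] `&` quantile @^-1` A) = m A.
Proof.
have mI : measurable ([set` `[0, fine (m setT)[] : set (measurableTypeR R)).
  exact: measurable_itv.
pose lam := mrestr (@lebesgue_measure R) mI.
move=> mA; rewrite setIC -[LHS]/(pushforward lam quantile A).
apply/esym; apply: (@cantor_measure_unique R m (pushforward lam quantile)) => //.
  exact: measurable_quantile.
move=> mq n w.
transitivity (lebesgue_measure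
    ([set` `[0, fine (m setT)[] `&` quantile @^-1` word_cylinder n w)).
  rewrite quantile_itv.
  rewrite lebesgue_measure_itv/= lte_fin ltrDl -massE.
  (* A word of mass 0 has an empty interval. *)
  by case: ltgtP (mass_ge0 n w) => // [m0|<-] _; rewrite -?EFinB// addrC addKr.
by rewrite setIC.
Qed.

End quantile.

(** * Scott Borel sets seen through codes *)

Section scott_borel.
Context {d : Order.disp_t} {D : porderType d}.
Variables (x0 : D) (b : nat -> D).
Hypothesis Bb : is_basis (range b).

Lemma measurable_basis_code :
  measurable_fun setT (basis_code b : borel (scott x0) -> borel cantor_space).
Proof.
apply: measurable_fun_cantor => n w; elim: n => [|n IH].
  by rewrite word_cylinder0 preimage_setT.
rewrite word_cylinderS preimage_setI; apply: measurableI => //.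
have mb : measurable ([set y | way_below (b n) y] : set (borel (scott x0))).
  by apply: sub_sigma_algebra; exact: scott_open_way_above Bb.
case: (w n).
  rewrite (_ : _ @^-1` _ = [set y | way_below (b n) y])//.
  by apply/seteqP; split=> y /asboolP.
rewrite (_ : _ @^-1` _ = ~` [set y | way_below (b n) y]); first exact: measurableC.
by apply/seteqP; split=> y /=; [move/negbT/asboolPn|move/asboolPn/negbTE].
Qed.

(** Preimages of Borel sets of codes form a sigma-algebra, so it suffices to treat Scott open
    sets. *)
Lemma measurable_scott_code (A : set (borel (scott x0))) : measurable A ->
  exists2 A' : set (borel cantor_space), measurable A' & A = basis_code b @^-1` A'.
Proof.
have /smallest_sub : sigma_algebra setT (preimage_set_system setT
    (basis_code b : borel (scott x0) -> _) (@measurable _ (borel cantor_space))).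
  exact: sigma_algebra_preimage (sigma_algebra_measurable _).
move=> /(_ (@open (scott x0))) + mA => /(_ _ A mA)[|A' mA' <-]; last first.
  by exists A' => //; rewrite setTI.
(* A point lies in [U] exactly when some basis element of [U] is way below it, which its code
   records as a digit [true]. *)
move=> U oU; exists (\bigcup_(n in b @^-1` U) [set w | w n = true]).
  by apply: bigcup_measurable => n _; exact: measurable_coord.
rewrite setTI [RHS](scott_open_basisE Bb oU); apply/seteqP; split=> x.
  by move=> [n Un /asboolP nx]; exists (b n) => //; split=> //; exists n.
by move=> [_ [[n _ <-] Un] nx]; exists n => //; exact/asboolP.
Qed.

End scott_borel.

(** * Construction of the partial map *)

Lemma countable_basis_enum (d : Order.disp_t) (D : porderType d) (x0 : D) :
  countably_based D -> exists b : nat -> D, is_basis (range b).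
Proof.
move=> [B /pfcard_geP[B0|[b]] Bb]; last first.
  by exists b; rewrite (image_eq b).
(* The basis is nonempty, since some basis element is way below [x0]. *)
by have [[y []]] := (Bb x0).1; rewrite B0.
Qed.

Theorem theorem3p4 (R : realType) (d : Order.disp_t) (D : porderType d)
    (hD : is_domain D) (hcount : countably_based D) (hcoh : coherent D)
    (x0 : D)
    (nuC : probability (borel cantor_space) R) (hnuC : uniform_product nuC)
    (mu : subprobability (borel (scott x0)) R) :
  exists (dom : set (borel cantor_space))
         (f : borel cantor_space -> borel (scott x0)),
    [/\ measurable dom,
        measurable_fun dom f &
        forall A : set (borel (scott x0)), measurable A ->
          nuC (dom `&` f @^-1` A) = mu A].
Proof.
have [b Bb] := countable_basis_enum x0 hcount.
have mcode := @measurable_basis_code d D x0 b Bb.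
pose code : borel (scott x0) -> borel cantor_space := basis_code b.
have [m mE] : exists m : {measure set (borel cantor_space) -> \bar R},
    forall A, m A = mu (code @^-1` A).
  by unshelve eexists (pushforward mu code); first exact: mcode.
have mT1 : (m setT <= 1)%E by rewrite mE preimage_setT sprobability_setT.
have mT : (m setT < +oo)%E by rewrite (le_lt_trans mT1) ?ltey.
pose T : set R := [set` `[0, fine (m setT)[].
(* The total mass is at most 1, so [T] lies where binary values are uniformly distributed. *)
have T01 : T `<=` `[0, 1[.
  move=> u; rewrite /T /= !in_itv/= => /andP[-> /=] /lt_le_trans; apply.
  by rewrite -lee_fin fineK// ge0_fin_numE.
pose h c := quantile m (binary_value c).
(* Restricting to values in [T] discards probability 1 - m(C), the mass that [mu] lacks; the second
   condition makes [h c] the code of a point. *)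
pose dom := binary_value @^-1` T `&` h @^-1` rounded_ideal b.
pose f c : borel (scott x0) := xget x0 [set y | code y = h c].
have codef c : dom c -> code (f c) = h c.
  move=> [_ /=]; rewrite -(range_basis_code hD.1 Bb) => -[y _ yc].
  exact: (@xgetI _ x0 [set y | code y = h c] y).
have mQ (A : set (borel cantor_space)) : measurable A ->
    measurable (T `&` quantile m @^-1` A).
  move=> mA; apply: measurableI; first exact: measurable_itv.
  by rewrite -[X in measurable X]setTI; exact: measurable_quantile.
have mU (A : set R) : measurable A -> measurable (binary_value @^-1` A).
  by move=> mA; rewrite -[X in measurable X]setTI; exact: measurable_binary_value.
have mI (A : set (borel cantor_space)) : measurable A ->
    measurable (rounded_ideal b `&` A).
  by move=> mA; apply: measurableI => //; exact: measurable_rounded_ideal.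
(* The choice made by [f] does not affect measurability: preimages of sets [code @^-1] A depend on
   [f c] only through its code [h c]. *)
have domf (A : set (borel cantor_space)) : dom `&` f @^-1` (code @^-1` A) =
    binary_value @^-1` (T `&` quantile m @^-1` (rounded_ideal b `&` A)).
  apply/seteqP; split=> c.
    by move=> [domc]; rewrite /= codef//; case: domc.
  move=> [Tc [Ic Ac]]; have domc : dom c by [].
  by split=> //; rewrite /= codef.
have mdom : measurable dom.
  apply: (mU (T `&` quantile m @^-1` rounded_ideal b)).
  exact: mQ _ (measurable_rounded_ideal b).
exists dom, f; split=> //.
  move=> _ _ /(measurable_scott_code Bb)[A mA ->].
  by rewrite domf; apply: mU; apply: mQ; exact: mI.
move=> _ /(measurable_scott_code Bb)[A mA ->].
rewrite domf uniform_binary_value//; last by apply: mQ; exact: mI.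
rewrite setIA (setIidr T01) lebesgue_quantile//; last exact: mI.
(* Every code is a rounded ideal, so intersecting with [rounded_ideal b] leaves the preimage in [D]
   unchanged. *)
rewrite mE; congr (mu _); apply/seteqP; split=> x; first by case.
by split=> //; rewrite -(range_basis_code hD.1 Bb); exists x.
Qed.
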